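(* The class $\mathcal L$ of Lebesgue fuzzy metric spaces is strictly contained in the class $\mathcal G$ of weak $G$-complete fuzzy metric spaces, $\mathcal L\subsetneq\mathcal G$; that is, every Lebesgue fuzzy metric space is weak $G$-complete, and there exists a weak $G$-complete fuzzy metric space that is not Lebesgue.
   Context: A continuous $t$-norm is a binary operation $*$ on $[0,1]$ that is associative, commutative, continuous on $[0,1]\times[0,1]$, satisfies $a*1=a$ for all $a\in[0,1]$, and satisfies $a*c\le b*d$ whenever $a\le b$ and $c\le d$. A fuzzy metric space (George–Veeramani) is a triple $(X,M,* )$ where $X$ is a non-empty set, $*$ is a continuous $t$-norm and $M:X\times X\times(0,\infty)\to[0,1]$ satisfies, for all $x,y,z\in X$ and $s,t>0$: (a) $M(x,y,t)>0$; (b) $M(x,y,t)=1$ if and only if $x=y$; (c) $M(x,y,t)=M(y,x,t)$; (d) $M(x,y,t)*M(y,z,s)\le M(x,z,t+s)$; (e) $M(x,y,\cdot):(0,\infty)\to[0,1]$ is continuous. For $x\in X$, $r\in(0,1)$, $t>0$ put $B_M(x,r,t)=\{y\in X: M(x,y,t)>1-r\}$; these sets form a base of a topology $\tau_M$ on $X$. Convergence and cluster points of sequences are taken in $(X,\tau_M)$. A fuzzy metric space $(X,M,* )$ is Lebesgue if for every open cover $\mathcal G_0$ of $(X,\tau_M)$ there exist $r\in(0,1)$ and $t>0$ such that each $B_M(x,r,t)$, $x\in X$, is contained in some member of $\mathcal G_0$. A sequence $(x_n)$ in $(X,M,* )$ is $G$-Cauchy if $\lim_{n\to\infty}M(x_n,x_{n+p},t)=1$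 for each $t>0$ and $p\in\mathbb N$ (equivalently, $\lim_{n\to\infty}M(x_n,x_{n+1},t)=1$ for all $t>0$). A fuzzy metric space is weak $G$-complete if every $G$-Cauchy sequence in it has a cluster point in it. *)

(* Defs.v *)
From HB Require Import structures.
From mathcomp Require Import all_boot all_order all_algebra.
From mathcomp Require Import all_classical all_reals all_analysis.
From mathcomp Require Import lra.
Set Implicit Arguments.
Unset Strict Implicit.
Unset Printing Implicit Defensive.
Import Order.TTheory GRing.Theory Num.Theory.
Import numFieldNormedType.Exports.
Local Open Scope classical_set_scope.
Local Open Scope ring_scope.

(* A binary operation on [0, 1] is a total function on R, all of whose        *)
(* properties are required on [0, 1] only.                                    *)
Record continuous_tnorm (R : realType) (op : R -> R -> R) : Prop := {
  tnorm_closed : {in `[0, 1] &, forall a b, op a b \in `[0, 1]} ;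
  tnormA : {in `[0, 1] & &, associative op} ;
  tnormC : {in `[0, 1] &, commutative op} ;
  tnorm_continuous :
    {within [set` `[0, 1]] `*` [set` `[0, 1]],
      continuous (fun p : R * R => op p.1 p.2)} ;
  tnorm1 : {in `[0, 1], forall a, op a 1 = a} ;
  tnorm_le : forall a b c d : R,
    a \in `[0, 1] -> b \in `[0, 1] -> c \in `[0, 1] -> d \in `[0, 1] ->
    a <= b -> c <= d -> op a c <= op b d
}.

(* M : X * X * ]0, +oo[ -> [0, 1] is a total function into R; M x y t is      *)
(* unconstrained, and never used, for t <= 0.                                 *)
Record fuzzy_metric (R : realType) (X : Type) (M : X -> X -> R -> R)
    (op : R -> R -> R) : Prop := {
  fm_range : forall x y (t : R), 0 < t -> M x y t \in `[0, 1] ;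
  fm_gt0 : forall x y (t : R), 0 < t -> 0 < M x y t ;
  fm_eq1 : forall x y (t : R), 0 < t -> M x y t = 1 <-> x = y ;
  fm_sym : forall x y (t : R), 0 < t -> M x y t = M y x t ;
  fm_triangle : forall x y z (s t : R), 0 < s -> 0 < t ->
    op (M x y t) (M y z s) <= M x z (t + s) ;
  fm_continuous : forall x y, {within [set` `]0, +oo[], continuous (M x y)}
}.
Arguments fm_continuous {R X M op} _ x y.

Record fuzzyMetricSpace (R : realType) := FuzzyMetricSpace {
  fms_carrier :> Type ;
  fms_inhabited : inhabited fms_carrier ;
  fms_M : fms_carrier -> fms_carrier -> R -> R ;
  fms_tnorm : R -> R -> R ;
  fms_tnormP : continuous_tnorm fms_tnorm ;
  fms_metricP : fuzzy_metric fms_M fms_tnorm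
}.

Definition fball (R : realType) (S : fuzzyMetricSpace R) (x : S) (r t : R) :
  set S := [set y | fms_M x y t > 1 - r].

Definition fballs (R : realType) (S : fuzzyMetricSpace R) : set (set S) :=
  [set B | exists x r t, [/\ 0 < r < 1, 0 < t & B = fball x r t]].
Arguments fballs {R} S _.

Section fuzzy_topology.
Context {R : realType} (S : fuzzyMetricSpace R).
Implicit Types x y z : S.

Let metS := fms_metricP S.
Let tnS := fms_tnormP S.

Lemma fball_center x (r t : R) : 0 < r -> 0 < t -> fball x r t x.
Proof.
by move=> r0 t0; rewrite /fball /= (fm_eq1 metS x x t0).2// ltrBlDr ltrDl.
Qed.

Lemma fball_nested x y (r t : R) : 0 < r < 1 -> 0 < t -> fball x r t y ->
  exists r' t', [/\ 0 < r' < 1, 0 < t' & fball y r' t' `<=` fball x r t].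
Proof.
move=> /andP[r0 r1] t0 xy.
have [s /andP[s0 st] xys] : exists2 s : R, 0 < s < t & 1 - r < fms_M x y s.
  have /subspace_continuousP/(_ t) := fm_continuous metS x y.
  rewrite /= in_itv/= t0 => /(_ isT)/cvgr_gt/(_ _ xy).
  rewrite near_withinE near_nbhs => /nbhs_ballP[e /= e0 he].
  pose d := Num.min (e / 2) (t / 2).
  have d0 : 0 < d by rewrite lt_min !divr_gt0.
  have de : d < e by rewrite gt_min ltr_pdivrMr// ltr_pMr// ltr1n.
  have dt : d < t by rewrite gt_min [X in _ || X]ltr_pdivrMr// ltr_pMr// ltr1n orbT.
  exists (t - d); first by rewrite subr_gt0 dt/= ltrBlDr ltrDl.
  apply: he; last by rewrite /= in_itv/= andbT subr_gt0.
  by rewrite /ball/= opprB addrCA subrr addr0 gtr0_norm.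
set a := fms_M x y s.
have aI : a \in `[0, 1] by exact: (fm_range metS).
have [c /andP[c0 c1] hc] : exists2 c : R, 0 < c < 1 & 1 - r < fms_tnorm S a c.
  have /subspace_continuousP/(_ (a, 1)) := tnorm_continuous tnS.
  have I1 : (1 : R) \in `[0, 1] by rewrite in_itv/= ler01 lexx.
  move=> /(_ (conj aI I1)); rewrite /from_subspace/= (tnorm1 tnS)// => /cvgr_gt/(_ _ xys).
  rewrite near_withinE near_nbhs => /nbhs_ballP[e /= e0 he].
  pose d := Num.min (e / 2) (1 / 2).
  have d0 : 0 < d by rewrite lt_min !divr_gt0.
  have de : d < e by rewrite gt_min ltr_pdivrMr// ltr_pMr// ltr1n.
  have d1 : d < 1 by rewrite gt_min [X in _ || X]ltr_pdivrMr// mul1r ltr1n orbT.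
  exists (1 - d); first by rewrite subr_gt0 d1/= ltrBlDr ltrDl.
  apply: (he (a, 1 - d)); last first.
    split=> //=; rewrite in_itv/= subr_ge0 (ltW d1)/= lerBlDr lerDl.
    exact: ltW.
  split=> /=; first exact: ballxx.
  by rewrite /ball/= opprB addrCA subrr addr0 gtr0_norm.
exists (1 - c), (t - s); split.
- by rewrite subr_gt0 c1/= ltrBlDr ltrDl.
- by rewrite subr_gt0.
move=> z; rewrite /fball /= opprB addrCA subrr addr0 => yz.
have ts : 0 < t - s by rewrite subr_gt0.
apply: (lt_le_trans hc).
have := fm_triangle metS x y z ts s0.
rewrite [s + _]addrC subrK; apply: le_trans.
apply: (tnorm_le tnS) => //; last exact: ltW.
- by rewrite in_itv/= (ltW c0) ltW.
- exact: (fm_range metS).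
Qed.

Lemma fball_shrink x (r t r' t' : R) : r' <= r -> 0 < t' -> t' <= t ->
  fball x r' t' `<=` fball x r t.
Proof.
move=> rr t'0 tt y; rewrite /fball /= => xy.
suff : fms_M x y t' <= fms_M x y t by lra.
have [<-//|tt'] := eqVneq t' t.
have t't : 0 < t - t' by rewrite subr_gt0 lt_neqAle tt'.
have := fm_triangle metS x y y t't t'0.
rewrite (fm_eq1 metS y y t't).2// [t' + _]addrC subrK (tnorm1 tnS)//.
exact: (fm_range metS).
Qed.

Lemma fballs_cover : \bigcup_(B in fballs S) B = setT.
Proof.
apply/seteqP; split=> // x _; exists (fball x (1 / 2) 1).
  by exists x, (1 / 2), 1; split => //; lra.
by apply: fball_center; lra.
Qed.

Lemma fballs_join (A B : set S) x : fballs S A -> fballs S B -> A x -> B x ->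
  exists C, [/\ fballs S C, C x & C `<=` A `&` B].
Proof.
move=> [a [r [t [hr ht ->]]]] [b [q [u [hq hu ->]]]].
move=> /(fball_nested hr ht)[r1 [t1 [hr1 ht1 sub1]]].
move=> /(fball_nested hq hu)[r2 [t2 [hr2 ht2 sub2]]].
have h0 : 0 < Num.min r1 r2 < 1.
  by rewrite lt_min gt_min; case/andP: hr1 => -> ->; case/andP: hr2 => -> _.
have t0 : 0 < Num.min t1 t2 by rewrite lt_min ht1.
exists (fball x (Num.min r1 r2) (Num.min t1 t2)); split.
- by exists x, (Num.min r1 r2), (Num.min t1 t2).
- by apply: fball_center => //; case/andP: h0.
- move=> y xy; split.
    by apply: sub1; apply: fball_shrink xy; rewrite // ge_min lexx.
  by apply: sub2; apply: fball_shrink xy; rewrite // ge_min lexx orbT.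
Qed.

HB.instance Definition _ := gen_eqMixin (fms_carrier S).
HB.instance Definition _ := gen_choiceMixin (fms_carrier S).
HB.instance Definition _ := isBaseTopological.Build (fms_carrier S)
  (b := id) fballs_cover fballs_join.

Lemma open_fballsP (U : set S) :
  open U <-> forall x, U x -> exists2 B, fballs S B & B x /\ B `<=` U.
Proof.
split=> [[D DB <-] x [B DBx Bx]|UB].
  by exists B; [exact: DB|split=> // y By; exists B].
exists [set B | fballs S B /\ B `<=` U]; first by move=> B [].
apply/seteqP; split=> [x [B [_ BU]]|x /UB[B bB [Bx BU]]]; first exact: BU.
by exists B.
Qed.

Lemma open_fballP (U : set S) : open U <-> forall x, U x ->
  exists r t, [/\ 0 < r < 1, 0 < t & fball x r t `<=` U].
Proof.
rewrite open_fballsP; split=> UB x Ux.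
  have [B [a [r [t [hr ht ->]]]] [ax aU]] := UB _ Ux.
  have [r' [t' [hr' ht' sub]]] := fball_nested hr ht ax.
  by exists r', t'; split=> //; exact: subset_trans aU.
have [r [t [hr ht sub]]] := UB _ Ux.
exists (fball x r t); first by exists x, r, t.
by split=> //; apply: fball_center => //; case/andP: hr.
Qed.

End fuzzy_topology.

Definition lebesgue (R : realType) (S : fuzzyMetricSpace R) : Prop :=
  forall G0 : set (set S),
    (forall G, G0 G -> open G) -> \bigcup_(G in G0) G = setT ->
    exists r t : R, [/\ 0 < r < 1, 0 < t &
      forall x : S, exists2 G, G0 G & fball x r t `<=` G].

Definition G_cauchy (R : realType) (S : fuzzyMetricSpace R) (x : nat -> S) :
    Prop :=
  forall (t : R) (p : nat), 0 < t ->
    fms_M (x n) (x (n + p)%N) t @[n --> \oo] --> (1 : R).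

Definition weak_G_complete (R : realType) (S : fuzzyMetricSpace R) : Prop :=
  forall x : nat -> S, G_cauchy x -> exists z : S, cluster (x @ \oo) z.

(* Main.v *)
Require Import Defs.
From mathcomp Require Import all_boot all_order all_algebra.
From mathcomp Require Import all_classical all_reals all_analysis.
From mathcomp Require Import lra.

(** A [G]-Cauchy sequence without cluster point has a closed discrete range, so
    every point has a neighbourhood meeting the range at most in that point. A
    Lebesgue pair [(r, t)] for the cover by these neighbourhoods makes the
    sequence eventually constant, a contradiction.
    For strictness, take pairs of points [(k, true)], [(k, false)] at distance
    [1 / (k + 2)], distinct pairs being at distance [1 / 2]; this ultrametric [d]
    gives the stationary fuzzy metric [M = 1 - d] for the minimum [t]-norm. A
    [G]-Cauchy sequence is eventually trapped in one pair, hence eventually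
    constant, whereas the open cover by singletons has no Lebesgue pair. *)

Set Implicit Arguments.
Unset Strict Implicit.
Unset Printing Implicit Defensive.
Import Order.TTheory GRing.Theory Num.Theory.
Import numFieldNormedType.Exports.
Local Open Scope classical_set_scope.
Local Open Scope ring_scope.

Lemma cluster_eventually_constant (T : topologicalType) (x : nat -> T) (N : nat) :
  (forall n, (N <= n)%N -> x n.+1 = x n) -> cluster (x @ \oo) (x N).
Proof.
move=> xS A B [K _ KA] /nbhs_singleton BxN.
have xE n : x (N + n)%N = x N.
  by elim: n => [|n <-]; [rewrite addn0 | rewrite addnS xS ?leq_addr].
exists (x N); split=> //; rewrite -(xE K); apply: KA.
by rewrite /= leq_addl.
Qed.

Section fuzzy_metric_space.
Context {R : realType} (S : fuzzyMetricSpace R).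
Implicit Types x y z : S.

Lemma nbhs_fball x (r t : R) : 0 < r < 1 -> 0 < t -> nbhs x (fball x r t).
Proof.
move=> hr t0; apply: open_nbhs_nbhs; split.
  by apply/open_fballP => y; exact: fball_nested.
by apply: fball_center => //; case/andP: hr.
Qed.

(** This is the T1 property: the ball about [x] of radius [1 - fms_M x y 1] at scale 1 misses [y],
    because balls are defined by a strict inequality. *)
Lemma nbhs_neq x y : x <> y -> nbhs x [set z | z <> y].
Proof.
move=> xy; have t0 : (0 : R) < 1 by [].
have M0 := fm_gt0 (fms_metricP S) x y t0.
have := fm_range (fms_metricP S) x y t0; rewrite in_itv/= => /andP[_ M1].
have M1' : fms_M x y 1 != 1.
  by apply/eqP => /(fm_eq1 (fms_metricP S) x y t0).
have {M1'}M1 : fms_M x y 1 < 1 by rewrite lt_neqAle M1'.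
have hr : 0 < 1 - fms_M x y 1 < 1 by lra.
apply: filterS (nbhs_fball x hr t0) => z; rewrite /fball /= => + zy.
by rewrite zy opprB addrCA subrr addr0 ltxx.
Qed.

Lemma G_cauchy_near (x : nat -> S) (r t : R) : G_cauchy x -> 0 < r -> 0 < t ->
  exists N, forall n, (N <= n)%N -> fball (x n) r t (x n.+1).
Proof.
move=> xC r0 t0; have r1 : 1 - r < 1 by rewrite ltrBlDr ltrDl.
have [N _ xN] := cvgr_gt _ (xC t 1%N t0) _ r1.
by exists N => n Nn; rewrite -addn1; exact: xN.
Qed.

(** Some neighbourhood of [z] misses a whole tail of the sequence; the finitely many earlier terms
    that differ from [z] are removed one at a time by [nbhs_neq]. *)
Lemma not_cluster_isolated (x : nat -> S) z : ~ cluster (x @ \oo) z ->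
  exists U : set S, [/\ open U, U z & forall n, U (x n) -> x n = z].
Proof.
move=> ncl.
have [B [zB [N xB]]] : exists B : set S, nbhs z B /\
    exists N, forall n, (N <= n)%N -> ~ B (x n).
  apply: contra_notP ncl => noB A B [N _ NA] zB.
  apply: contra_notP noB => AB; exists B; split=> //; exists N => n Nn Bxn.
  by apply: AB; exists (x n); split=> //; exact: NA.
have zF : nbhs z [set y | forall n, (n < N)%N -> y = x n -> x n = z].
  elim: N {xB} => [|N IH]; first exact: filterE.
  have zN : nbhs z [set y | y = x N -> x N = z].
    have [xNz|/eqP xNz] := eqVneq (x N) z; first by apply: filterE => y _.
    have : z <> x N by move=> e; exact: xNz.
    by move=> /nbhs_neq; apply: filterS => y yN /yN.
  apply: filterS2 IH zN => y yn yN n.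
  by rewrite ltnS leq_eqVlt => /predU1P[->|/yn].
exists (interior (B `&` [set y | forall n, (n < N)%N -> y = x n -> x n = z])).
split; [exact: open_interior | exact: filterI |].
move=> n /interior_subset[Bxn xnF].
by have [/xB|/xnF] := leqP N n; last exact.
Qed.

Lemma lebesgue_weak_G_complete : lebesgue S -> weak_G_complete S.
Proof.
move=> SL x xC; apply: contrapT => /forallNP ncl.
pose G0 : set (set S) :=
  [set U | open U /\ exists z, forall n, U (x n) -> x n = z].
have [|| r [t [/andP[r0 _] t0 sub]]] := SL G0; first by move=> U [].
  rewrite -subTset => z _.
  have [U [oU Uz Ux]] := not_cluster_isolated (ncl z).
  by exists U => //; split=> //; exists z.
have [N xN] := G_cauchy_near xC r0 t0.
apply: (ncl (x N)); apply: cluster_eventually_constant => n Nn.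
(* The ball about [x n] contains both [x n] and [x n.+1], and the member [U] of the cover containing
   it carries at most one value of the sequence. *)
have [U [_ [z Uz]] bU] := sub (x n).
rewrite (Uz n.+1); last by apply: bU; exact: xN.
by rewrite (Uz n)//; apply: bU; exact: fball_center.
Qed.

End fuzzy_metric_space.

Lemma continuous_tnorm_min (R : realType) : @continuous_tnorm R Num.min.
Proof.
split.
- by move=> a b aI bI; case: (leP a b).
- by move=> a b c _ _ _; exact: minA.
- by move=> a b _ _; exact: minC.
- apply: continuous_subspaceT => p; apply: continuous_min; [exact: cvg_fst | exact: cvg_snd].
- by move=> a; rewrite in_itv/= => /andP[_ a1]; exact/min_idPl.
- by move=> a b c d _ _ _ _ ab cd; rewrite le_min !ge_min ab cd orbT.
Qed.

Section pairs.
Context (R : realType).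
Implicit Types x y z : nat * bool.

(** The offset 2 keeps the distance inside a pair at most 1/2, the distance between pairs: this
    gives the ultrametric inequality and keeps [pairs_M] positive. *)
Definition pairs_M x y (t : R) : R :=
  if x == y then 1 else if x.1 == y.1 then 1 - (x.1.+2)%:R^-1 else 2^-1.

Lemma invS2_gt0 (k : nat) : 0 < (k.+2)%:R^-1 :> R.
Proof. by rewrite invr_gt0 ltr0n. Qed.

Lemma invS2_le (k : nat) : (k.+2)%:R^-1 <= 2^-1 :> R.
Proof. by rewrite lef_pV2 ?posrE ?ltr0n// ler_nat. Qed.

Lemma pairs_M_ge x y t : 2^-1 <= pairs_M x y t.
Proof.
rewrite /pairs_M; move: (_^-1) (invS2_le x.1) => w w2.
by case: ifP => _; [|case: ifP => _]; lra.
Qed.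

Lemma pairs_M_le1 x y t : pairs_M x y t <= 1.
Proof.
rewrite /pairs_M; move: (_^-1) (invS2_gt0 x.1) => w w0.
by case: ifP => _; [|case: ifP => _]; lra.
Qed.

Lemma pairs_M_fst x y t : 2^-1 < pairs_M x y t -> x.1 = y.1.
Proof.
by rewrite /pairs_M; case: eqP => [->//|_]; case: eqP => // _; rewrite ltxx.
Qed.

(** The partner of [x] attains the bound exactly and points of other pairs give 1/2, which is no
    larger. So the ball of this radius about [x] is a singleton. *)
Lemma pairs_M_eq x y t : 1 - (x.1.+2)%:R^-1 < pairs_M x y t -> x = y.
Proof.
rewrite /pairs_M; move: (_^-1) (invS2_le x.1) => w w2.
by case: eqP => // _; case: ifP => _ ?; exfalso; lra.
Qed.

Lemma fuzzy_metric_pairs : fuzzy_metric pairs_M Num.min.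
Proof.
have M0 x y t : 0 < pairs_M x y t.
  by apply: lt_le_trans (pairs_M_ge x y t); rewrite invr_gt0.
split.
- by move=> x y t _; rewrite in_itv/= pairs_M_le1 ltW.
- by move=> x y t _.
- move=> x y t _; split=> [Mxy|->]; last by rewrite /pairs_M eqxx.
  by apply: (@pairs_M_eq _ _ t); rewrite Mxy ltrBlDr ltrDl invS2_gt0.
- move=> x y t _; rewrite /pairs_M eq_sym [y.1 == _]eq_sym.
  by case: ifP => // _; case: eqP => // ->.
- move=> x y z s t _ _; rewrite ge_min.
  have [->|xy] := eqVneq x y; first by rewrite {2 3}/pairs_M lexx orbT.
  have [->|yz] := eqVneq y z; first by rewrite {1 2}/pairs_M lexx.
  (* A leg joining distinct pairs has value 1/2, a lower bound of [pairs_M]. *)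
  have [xy1|xy1] := eqVneq x.1 y.1; last first.
    by rewrite {1}/pairs_M (negPf xy) (negPf xy1) pairs_M_ge.
  have [yz1|yz1] := eqVneq y.1 z.1; last first.
    by rewrite {3}/pairs_M (negPf yz) (negPf yz1) pairs_M_ge orbT.
  (* All three points share a pair and [x] differs from [y], so the value at [x], [z] is either 1 or
     the value at [x], [y]. *)
  apply/orP; left; rewrite /pairs_M (negPf xy) xy1 yz1 eqxx.
  by case: ifP => // _; rewrite gerBl ltW ?invS2_gt0.
- by move=> x y; apply: continuous_subspaceT => t; exact: cvg_cst.
Qed.

Definition pairs_space : fuzzyMetricSpace R :=
  FuzzyMetricSpace (inhabits (0%N, true)) (continuous_tnorm_min R)
    fuzzy_metric_pairs.

Lemma pairs_weak_G_complete : weak_G_complete pairs_space.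
Proof.
move=> x xC.
have h0 : (0 : R) < 2^-1 by rewrite invr_gt0.
(* Radius 1/2 excludes all other pairs, so the tail from [N] stays in the pair of [x N]. *)
have [N xN] := G_cauchy_near xC h0 ltr01.
have xN1 n : (x (N + n)%N).1 = (x N).1.
  elim: n => [|n <-]; first by rewrite addn0.
  have := xN _ (leq_addr n N); rewrite /fball /= addnS => h.
  by apply/esym/(@pairs_M_fst _ _ 1); lra.
(* With the pair now fixed, its own isolating radius applies along the whole tail and makes
   consecutive terms equal. *)
have [K xK] := G_cauchy_near xC (invS2_gt0 (x N).1) ltr01.
exists (x (N + K)%N); apply: cluster_eventually_constant => n NKn.
have Nn : (N <= n)%N := leq_trans (leq_addr _ _) NKn.
have := xK _ (leq_trans (leq_addl _ _) NKn).
by rewrite /fball /= -(xN1 (n - N)%N) subnKC// => /pairs_M_eq.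
Qed.

Lemma open_pairs_set1 (z : pairs_space) : open [set z].
Proof.
apply/open_fballP => _ ->; exists (z.1.+2)%:R^-1, 1; split=> //.
  by rewrite invS2_gt0/= invf_lt1 ?ltr0n// ltr1n.
by move=> y; rewrite /fball /= => /pairs_M_eq ->.
Qed.

(** The distances inside the pairs tend to 0, so for every [r] some ball of radius [r] contains both
    points of a pair and fits in no singleton. *)
Lemma pairs_not_lebesgue : ~ lebesgue pairs_space.
Proof.
move=> /(_ (range (fun z : pairs_space => [set z])))[||r [t [/andP[r0 _] t0 sub]]].
- by move=> _ [z _ <-]; exact: open_pairs_set1.
- by rewrite -subTset => z _; exists [set z] => //; exists z.
have [k kr] : exists k : nat, (k.+2)%:R^-1 < r.
  (* For [k] the integer part of [r^-1], already [k + 1] exceeds [r^-1]. *)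
  exists (Num.truncn r^-1); rewrite -[ltRHS]invrK ltf_pV2 ?posrE ?invr_gt0 ?ltr0n//.
  by rewrite (lt_trans (truncnS_gt _))// ltr_nat.
have [_ [z _ <-] bz] := sub (k, true).
have zt : z = (k, true) by apply/esym/bz/fball_center.
have : (k, false) = z.
  by apply: bz; rewrite /fball /= /pairs_M xpair_eqE eqxx /= ltrD2l ltrN2.
by rewrite zt.
Qed.

End pairs.

Theorem mainTheorem4 (R : realType) :
  (forall S : fuzzyMetricSpace R, lebesgue S -> weak_G_complete S) /\
  (exists S : fuzzyMetricSpace R, weak_G_complete S /\ ~ lebesgue S).
Proof.
split=> [S|]; first exact: lebesgue_weak_G_complete.
exists (pairs_space R); split; first exact: pairs_weak_G_complete.
exact: pairs_not_lebesgue.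
Qed.
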